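(* The Szendrei expansion of inverse categories defines an expansion $\overline{Sz}:\mathrm{InvCat}\to\mathrm{InvCat}$. That is, the assignment $\mathcal{C}\mapsto\overline{Sz}(\mathcal{C})$ on objects and $f\mapsto\overline{Sz}(f)$ on morphisms, where $\overline{Sz}(f)(A,s)=(f(A),f(s))$, is a functor, and there is a natural transformation $\eta:\overline{Sz}\to \mathrm{Id}_{\mathrm{InvCat}}$ such that $\eta_{\mathcal{C}}:\overline{Sz}(\mathcal{C})\to\mathcal{C}$ is surjective for every inverse category $\mathcal{C}$.
   Context: An inverse category is a (small) category $\mathcal{C}$ in which every arrow $s:X\to Y$ has a unique arrow $s^\circ:Y\to X$ with $ss^\circ s=s$ and $s^\circ ss^\circ=s^\circ$. The composite $st$ means first $t$, then $s$. $\mathcal{C}$ also denotes its set of arrows and $\mathcal{C}^{(0)}$ its set of objects. For $s:X\to Y$ put $od(s)=X$, $or(s)=Y$, $id(s)=s^\circ s$, $ir(s)=ss^\circ$. The natural order: for parallel arrows $s,t:X\to Y$, $s\leqslant t$ iff $s=te$ for some idempotent $e:X\to X$. $\mathrm{InvCat}$ is the category whose objects are inverse categories and whose morphisms are functors (functors automatically preserve $(\ )^\circ$). Surjectivity of $\eta_{\mathcal{C}}$ means surjectivity on arrows (hence on objects). For an object $X$ and an idempotent $e:X\to X$ let $P_{e,X}(\mathcal{C})$ be the set of nonempty finite sets $A$ of arrows of $\mathcal{C}$ with $or(a)=X$ and $ir(a)=e$ for all $a\in A$; let $P(\mathcal{C})=\bigcup_{X,e}P_{e,X}(\mathcal{C})$.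 For $A\in P_{e,X}(\mathcal{C})$ put $o\varepsilon(A)=X$, $i\varepsilon(A)=e$. If $o\varepsilon(A)=od(s)$ and $i\varepsilon(A)\leqslant id(s)$, put $sA=\{sa:a\in A\}\in P(\mathcal{C})$. The Szendrei expansion $\overline{Sz}(\mathcal{C})$ (the semidirect product of the Bernoulli fibred action $(s,A)\mapsto sA$) is the inverse category with arrows the pairs $(A,s)$, $A\in P(\mathcal{C})$, $s\in\mathcal{C}$, $o\varepsilon(A)=or(s)$, $i\varepsilon(A)\leqslant ir(s)$; objects (identity arrows) the pairs $(A,1_{o\varepsilon(A)})$; $(A,s)(B,t)$ is defined iff $st$ is defined, $i\varepsilon(B)\leqslant id(s)$ and $A=sB$, and then it equals $(A,st)$; $(A,s)^\circ=(s^\circ A,s^\circ)$. For a functor $f:\mathcal{C}\to\mathcal{D}$ and $A\in P(\mathcal{C})$, $f(A)=\{f(a):a\in A\}$. *)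

(* Defs.v *)
From mathcomp Require Import all_boot.
From mathcomp Require Import boolp classical_sets functions cardinality.

Set Implicit Arguments.
Unset Strict Implicit.
Unset Printing Implicit Defensive.

Local Open Scope classical_set_scope.

(* Small categories are presented by a type of objects and a single type of
   arrows, with composition defined exactly on composable pairs; [comp s t h]
   is "first t, then s". *)
Record category := Category {
  ob : Type;
  arr :> Type;
  dom : arr -> ob;
  cod : arr -> ob;
  idn : ob -> arr;
  comp : forall s t : arr, dom s = cod t -> arr;
  dom_idn : forall X, dom (idn X) = X;
  cod_idn : forall X, cod (idn X) = X;
  dom_comp : forall s t (h : dom s = cod t), dom (comp h) = dom t;
  cod_comp : forall s t (h : dom s = cod t), cod (comp h) = cod s;
  comp_idl : forall s (h : dom (idn (cod s)) = cod s), comp h = s;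
  comp_idr : forall s (h : dom s = cod (idn (dom s))), comp h = s;
  compA : forall s t u (hst : dom s = cod t) (htu : dom t = cod u)
    (h1 : dom s = cod (comp htu)) (h2 : dom (comp hst) = cod u),
    comp h1 = comp h2 }.

Arguments idn {c} X.
Arguments comp {c} s t h.

Definition inverse_of (C : category) (s t : C) : Prop :=
  exists (h1 : dom s = cod t) (h2 : dom t = cod s),
    comp (comp s t h1) s (etrans (dom_comp h1) h2) = s /\
    comp (comp t s h2) t (etrans (dom_comp h2) h1) = t.

Record inverse_category := InverseCategory {
  icat :> category;
  inverseP : forall s : icat, exists! t : icat, inverse_of s t }.

Definition inv (C : inverse_category) (s : C) : C := projT1 (cid (inverseP s)).

Lemma invP (C : inverse_category) (s : C) : inverse_of s (inv s).
Proof. exact: (projT2 (cid (inverseP s))).1. Qed.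

Lemma inv_uniq (C : inverse_category) (s t : C) : inverse_of s t -> inv s = t.
Proof. exact: (projT2 (cid (inverseP s))).2. Qed.

Lemma cod_inv (C : inverse_category) (s : C) : cod (inv s) = dom s.
Proof. by have [h _] := invP s. Qed.

Lemma dom_inv (C : inverse_category) (s : C) : dom (inv s) = cod s.
Proof. by have [_ [h _]] := invP s. Qed.

(* id(s) = s°s *)
Definition ids (C : inverse_category) (s : C) : C := comp (inv s) s (dom_inv s).

(* ir(s) = ss° *)
Definition irs (C : inverse_category) (s : C) : C :=
  comp s (inv s) (esym (cod_inv s)).

Definition idempotent (C : category) (e : C) : Prop :=
  exists h : dom e = cod e, comp e e h = e.

(* Composability of e with itself and with t makes e an endomorphism of dom t,
   so s and t are automatically parallel. *)
Definition le (C : category) (s t : C) : Prop :=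
  exists e : C, idempotent e /\ exists h : dom t = cod e, s = comp t e h.

(* Adjoining a zero None makes composition a total associative operation. *)
Definition omul (C : category) (s t : option C) : option C :=
  if s isn't Some s' then None else if t isn't Some t' then None else
  if pselect (dom s' = cod t') is left h then Some (comp s' t' h) else None.

Definition oinv (C : inverse_category) (s : option C) : option C :=
  omap (@inv C) s.

Local Infix "**" := (@omul _) (at level 40, left associativity).

Lemma osome_inj (T : Type) (x y : T) : Some x = Some y -> x = y.
Proof. by case. Qed.

Lemma omulE (C : category) (s t : C) (h : dom s = cod t) :
  Some s ** Some t = Some (comp s t h).
Proof. by rewrite /=; case: pselect => // h'; rewrite (Prop_irrelevance h h'). Qed.

Lemma omul_some (C : category) (s t u : C) :
  Some s ** Some t = Some u -> exists h : dom s = cod t, u = comp s t h.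
Proof. by rewrite /=; case: pselect => // h [<-]; exists h. Qed.

Lemma omul_none (C : category) (s t : C) :
  dom s <> cod t -> Some s ** Some t = None.
Proof. by rewrite /=; case: pselect. Qed.

Arguments omul : simpl never.

Lemma omuln0 (C : category) (s : option C) : s ** None = None.
Proof. by case: s. Qed.

Lemma omulA (C : category) (s t u : option C) : s ** (t ** u) = s ** t ** u.
Proof.
case: s t u => [s|] // [t|] // [u|]; last by rewrite !omuln0.
have [hst|nst] := pselect (dom s = cod t); have [htu|ntu] := pselect (dom t = cod u).
- rewrite (omulE htu) (omulE hst).
  have h1 : dom s = cod (comp t u htu) by rewrite cod_comp.
  have h2 : dom (comp s t hst) = cod u by rewrite dom_comp.
  by rewrite (omulE h1) (omulE h2) (compA h1 h2).
- rewrite (omul_none ntu) (omulE hst) omuln0 omul_none //.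
  by rewrite dom_comp.
- rewrite (omul_none nst) (omulE htu) omul_none //.
  by rewrite cod_comp.
- by rewrite (omul_none nst) (omul_none ntu) omuln0.
Qed.

Lemma inverse_of_omul (C : category) (s t : C) :
  inverse_of s t <->
  Some s ** Some t ** Some s = Some s /\ Some t ** Some s ** Some t = Some t.
Proof.
split=> [[h1 [h2 [e1 e2]]]|[e1 e2]].
  by rewrite (omulE h1) (omulE h2) (omulE (etrans (dom_comp h1) h2))
             (omulE (etrans (dom_comp h2) h1)) e1 e2.
have [h1|n1] := pselect (dom s = cod t); last by rewrite (omul_none n1) in e1.
have [h2|n2] := pselect (dom t = cod s); last by rewrite (omul_none n2) in e2.
exists h1, h2; split; apply: (@osome_inj C).
  by rewrite -omulE -omulE.
by rewrite -omulE -omulE.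
Qed.

Lemma omulVK (C : inverse_category) (s : option C) : s ** oinv s ** s = s.
Proof. by case: s => // s; have /inverse_of_omul[] := invP s. Qed.

Lemma omulKV (C : inverse_category) (s : option C) :
  oinv s ** s ** oinv s = oinv s.
Proof. by case: s => // s; have /inverse_of_omul[] := invP s. Qed.

Lemma oinv_uniq (C : inverse_category) (s t : option C) :
  s ** t ** s = s -> t ** s ** t = t -> oinv s = t.
Proof.
case: s t => [s|] [t|] //= e1 e2; congr Some.
by apply: inv_uniq; apply/inverse_of_omul.
Qed.

Lemma oinvK (C : inverse_category) (s : option C) : oinv (oinv s) = s.
Proof. by apply: oinv_uniq; rewrite ?omulVK ?omulKV. Qed.

Lemma oinv_idem (C : inverse_category) (e : option C) : e ** e = e -> oinv e = e.
Proof. by move=> ee; apply: oinv_uniq; rewrite !ee. Qed.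

Lemma omul_idem (C : inverse_category) (e f : option C) :
  e ** e = e -> f ** f = f -> e ** f ** (e ** f) = e ** f.
Proof.
move=> ee ff; set x := oinv (e ** f).
have ek z : z ** e ** e = z ** e by rewrite -omulA ee.
have fk z : z ** f ** f = z ** f by rewrite -omulA ff.
have xK : e ** f ** x ** e ** f = e ** f by rewrite -[RHS]omulVK !omulA.
have Kx z : z ** x ** e ** f ** x = z ** x.
  by have := congr1 (omul z) (omulKV (e ** f)); rewrite -/x !omulA.
have xE : x = f ** x ** e by apply: oinv_uniq; rewrite !omulA ?ek ?fk ?Kx.
have xx : x ** x = x by rewrite xE !omulA Kx.
by rewrite -(oinvK (e ** f)) -/x (oinv_idem xx) xx.
Qed.

Lemma omul_idemC (C : inverse_category) (e f : option C) :
  e ** e = e -> f ** f = f -> e ** f = f ** e.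
Proof.
move=> ee ff; have ef := omul_idem ee ff; have fe := omul_idem ff ee.
have ek z : z ** e ** e = z ** e by rewrite -omulA ee.
have fk z : z ** f ** f = z ** f by rewrite -omulA ff.
rewrite -(oinv_idem ef).
by apply: oinv_uniq; rewrite !omulA ek fk -omulA ?ef ?fe.
Qed.

Lemma irs_idem (C : inverse_category) (s : option C) :
  s ** oinv s ** (s ** oinv s) = s ** oinv s.
Proof. by rewrite omulA omulVK. Qed.

Lemma ids_idem (C : inverse_category) (s : option C) :
  oinv s ** s ** (oinv s ** s) = oinv s ** s.
Proof. by rewrite omulA omulKV. Qed.

Lemma oinvM (C : inverse_category) (s t : option C) :
  oinv (s ** t) = oinv t ** oinv s.
Proof.
have c z : z ** t ** oinv t ** oinv s ** s = z ** oinv s ** s ** t ** oinv t.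
  by have := congr1 (omul z) (omul_idemC (irs_idem t) (ids_idem s));
     rewrite !omulA.
apply: oinv_uniq; rewrite !omulA; first by rewrite c omulVK -omulA -omulA (omulA t) omulVK.
by rewrite -c omulKV -omulA -omulA (omulA (oinv s)) omulKV.
Qed.

Lemma irsE (C : inverse_category) (s : C) :
  Some (irs s) = Some s ** oinv (Some s).
Proof. by rewrite -omulE. Qed.

Lemma idsE (C : inverse_category) (s : C) :
  Some (ids s) = oinv (Some s) ** Some s.
Proof. by rewrite -omulE. Qed.

Lemma invK (C : inverse_category) (s : C) : inv (inv s) = s.
Proof. by have [] := oinvK (Some s). Qed.

Lemma ids_inv (C : inverse_category) (s : C) : ids (inv s) = irs s.
Proof. by apply: (@osome_inj C); rewrite idsE irsE /= invK. Qed.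

Lemma leE (C : category) (s t : C) :
  le s t <-> exists e : option C, e ** e = e /\ Some s = Some t ** e.
Proof.
split=> [[e [[h ee] [k ->]]]|[[e|]]]; last by rewrite omuln0 => -[].
  by exists (Some e); rewrite (omulE h) ee (omulE k).
case=> ee st; have [h hE] := omul_some ee; have [k kE] := omul_some (esym st).
by exists e; split; [exists h | exists k].
Qed.

(* A nonempty finite set of arrows with a common codomain [oe] and a common
   idempotent ir(a) = [ie].  Being nonempty, such a set determines [oe] and
   [ie], so this is the union of the sets P_{e,X}(C). *)
Record finpart (C : inverse_category) := FinPart {
  elems :> set C;
  oe : ob C;
  ie : C;
  elems_finite : finite_set elems;
  elems_nonempty : elems !=set0;
  elems_cod : forall a, elems a -> cod a = oe;
  elems_irs : forall a, elems a -> irs a = ie }.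

Lemma finpart_eq (C : inverse_category) (A B : finpart C) :
  elems A = elems B -> A = B.
Proof.
case: A B => [A x e Af An Ac Ai] [B y f Bf Bn Bc Bi] /= AB.
case: B / AB Bf Bn Bc Bi => Bf Bn Bc Bi.
have [a Aa] := An.
have xy : x = y by rewrite -(Ac a Aa) (Bc a Aa).
have ef : e = f by rewrite -(Ai a Aa) (Bi a Aa).
case: y / xy Bc => Bc; case: f / ef Bi => Bi.
by congr FinPart; apply: Prop_irrelevance.
Qed.

Lemma cod_irs (C : inverse_category) (s : C) : cod (irs s) = cod s.
Proof. exact: cod_comp. Qed.

Lemma dom_irs (C : inverse_category) (s : C) : dom (irs s) = cod s.
Proof. by rewrite dom_comp dom_inv. Qed.

Lemma cod_ie (C : inverse_category) (A : finpart C) : cod (ie A) = oe A.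
Proof.
have [a Aa] := elems_nonempty A.
by rewrite -(elems_irs Aa) cod_irs (elems_cod Aa).
Qed.

Lemma ie_idem (C : inverse_category) (A : finpart C) :
  Some (ie A) ** Some (ie A) = Some (ie A).
Proof.
have [a Aa] := elems_nonempty A.
by rewrite -(elems_irs Aa) irsE irs_idem.
Qed.

(* sA *)
Definition lmul_set (C : category) (s : C) (A : set C) : set C :=
  [set u | exists2 a, A a & exists h : dom s = cod a, u = comp s a h].

Lemma lmul_setE (C : category) (s : C) (A : set C) (u : C) :
  lmul_set s A u <-> exists2 a, A a & Some s ** Some a = Some u.
Proof.
split=> [[a Aa [h ->]]|[a Aa /omul_some[h uE]]].
  by exists a => //; rewrite (omulE h).
by exists a => //; exists h.
Qed.

Lemma lmul_set_finite (C : category) (s : C) (A : set C) :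
  finite_set A -> finite_set (lmul_set s A).
Proof.
move=> fA; apply: (@sub_finite_set _ _
  ((fun a => odflt s (Some s ** Some a)) @` A)); last exact: finite_image.
by move=> u /lmul_setE[a Aa e]; exists a => //; rewrite e.
Qed.

Lemma lmul_set_nonempty (C : inverse_category) (s : C) (A : finpart C) :
  dom s = oe A -> lmul_set s A !=set0.
Proof.
move=> h; have [a Aa] := elems_nonempty A.
have k : dom s = cod a by rewrite (elems_cod Aa).
by exists (comp s a k), a => //; exists k.
Qed.

Lemma lmul_set_cod (C : category) (s : C) (A : set C) (u : C) :
  lmul_set s A u -> cod u = cod s.
Proof. by move=> [a _ [h ->]]; rewrite cod_comp. Qed.

Lemma irs_omul (C : inverse_category) (s a u : C) :
  Some s ** Some a = Some u ->
  Some (irs u) = Some s ** Some (irs a) ** oinv (Some s).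
Proof. by move=> uE; rewrite irsE -uE oinvM irsE !omulA. Qed.

Lemma lmul_set_irs (C : inverse_category) (s : C) (A : finpart C)
    (h : dom s = cod (ie A)) (u : C) :
  lmul_set s A u -> irs u = irs (comp s (ie A) h).
Proof.
move=> /lmul_setE[a Aa uE]; apply: (@osome_inj C).
rewrite (irs_omul uE) (elems_irs Aa) irsE -omulE oinvM (oinv_idem (ie_idem A)).
by rewrite [X in _ = X]omulA -(omulA _ (Some (ie A)) (Some (ie A))) ie_idem.
Qed.

Definition finpart_act (C : inverse_category) (s : C) (A : finpart C)
    (h : dom s = oe A) (l : le (ie A) (ids s)) : finpart C :=
  @FinPart C (lmul_set s A) (cod s)
    (irs (comp s (ie A) (etrans h (esym (cod_ie A)))))
    (lmul_set_finite s (elems_finite A)) (lmul_set_nonempty h)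
    (@lmul_set_cod C s A) (@lmul_set_irs C s A _).

Record sz_arrow (C : inverse_category) := SzArrow {
  sz_set : finpart C;
  sz_arr : C;
  sz_cod : oe sz_set = cod sz_arr;
  sz_le : le (ie sz_set) (irs sz_arr) }.

Lemma sz_arrow_eq (C : inverse_category) (x y : sz_arrow C) :
  elems (sz_set x) = elems (sz_set y) -> sz_arr x = sz_arr y -> x = y.
Proof.
case: x y => [A s c l] [B t c' l'] /= /finpart_eq AB st.
case: B / AB c' l' => c' l'; case: t / st c' l' => c' l'.
by congr SzArrow; apply: Prop_irrelevance.
Qed.

Lemma sz_dom_proof (C : inverse_category) (x : sz_arrow C) :
  le (ie (sz_set x)) (ids (inv (sz_arr x))).
Proof. by rewrite ids_inv; apply: sz_le. Qed.

(* (A, s)°(A, s) = (s°A, s°s); objects (A, 1) are represented by A alone. *)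
Definition sz_dom (C : inverse_category) (x : sz_arrow C) : finpart C :=
  finpart_act (etrans (dom_inv (sz_arr x)) (esym (sz_cod x))) (sz_dom_proof x).

Lemma omul1 (C : category) (s : C) : Some (idn (cod s)) ** Some s = Some s.
Proof.
have h : dom (idn (cod s)) = cod s by rewrite dom_idn.
by rewrite (omulE h) comp_idl.
Qed.

Lemma omulr1 (C : category) (s : C) : Some s ** Some (idn (dom s)) = Some s.
Proof.
have h : dom s = cod (idn (dom s)) by rewrite cod_idn.
by rewrite (omulE h) comp_idr.
Qed.

Lemma oidn_idem (C : category) (X : ob C) :
  Some (idn X) ** Some (idn X) = Some (@idn C X).
Proof. by have := omul1 (@idn C X); rewrite cod_idn. Qed.

Lemma inv_idn (C : inverse_category) (X : ob C) : inv (idn X) = @idn C X.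
Proof. by have [] := oinv_idem (oidn_idem (C := C) X). Qed.

Lemma irs_idn (C : inverse_category) (X : ob C) : irs (idn X) = @idn C X.
Proof. by apply: (@osome_inj C); rewrite irsE /= inv_idn; exact: oidn_idem. Qed.

Lemma sz_idn_proof (C : inverse_category) (A : finpart C) :
  le (ie A) (irs (idn (oe A))).
Proof.
apply/leE; exists (Some (ie A)); split; first exact: ie_idem.
by rewrite irs_idn -cod_ie omul1.
Qed.

Definition sz_idn (C : inverse_category) (A : finpart C) : sz_arrow C :=
  @SzArrow C A (idn (oe A)) (esym (cod_idn _)) (sz_idn_proof A).

(* e <= ss° means ss°e = e *)
Lemma le_irsE (C : inverse_category) (A : finpart C) (s : C) :
  le (ie A) (irs s) <->
  Some s ** oinv (Some s) ** Some (ie A) = Some (ie A).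
Proof.
split=> [/leE[e [ee ->]]|eE].
  by rewrite irsE omulA irs_idem.
by apply/leE; exists (Some (ie A)); split; rewrite ?ie_idem // irsE eE.
Qed.

Lemma le_idsE (C : inverse_category) (A : finpart C) (s : C) :
  le (ie A) (ids s) <->
  oinv (Some s) ** Some s ** Some (ie A) = Some (ie A).
Proof. by rewrite -[s]invK ids_inv le_irsE invK /= invK. Qed.

Lemma elem_ie (C : inverse_category) (A : finpart C) (a : C) :
  elems A a -> Some (ie A) ** Some a = Some a.
Proof. by move=> Aa; rewrite -(elems_irs Aa) irsE omulVK. Qed.

Lemma lmul_setM (C : category) (s t u : C) (A : set C) :
  Some s ** Some t = Some u -> lmul_set s (lmul_set t A) = lmul_set u A.
Proof.
move=> uE; apply/seteqP; split=> v /lmul_setE.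
  move=> [w /lmul_setE[a Aa wE] vE]; apply/lmul_setE; exists a => //.
  by rewrite -uE -omulA wE.
move=> [a Aa]; rewrite -uE -omulA.
case E: (Some t ** Some a) => [w|]; last by rewrite omuln0.
move=> vE; apply/lmul_setE; exists w => //.
by apply/lmul_setE; exists a.
Qed.

Lemma lmul_set_fix (C : inverse_category) (e : C) (A : finpart C) :
  Some e ** Some (ie A) = Some (ie A) -> lmul_set e A = A.
Proof.
move=> eA; have fix_a a : elems A a -> Some e ** Some a = Some a.
  by move=> Aa; rewrite -(elem_ie Aa) omulA eA.
apply/seteqP; split=> v.
  by move=> /lmul_setE[a Aa]; rewrite fix_a // => -[<-].
by move=> Av; apply/lmul_setE; exists v => //; exact: fix_a.
Qed.

Lemma ieE (C : inverse_category) (s : C) (A : finpart C) h l :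
  Some (ie (@finpart_act C s A h l)) =
  Some s ** Some (ie A) ** oinv (Some s).
Proof.
rewrite /= irsE -omulE oinvM (oinv_idem (ie_idem A)).
by rewrite omulA -(omulA _ (Some (ie A)) (Some (ie A))) ie_idem.
Qed.

Lemma sz_comp_cod (C : inverse_category) (x y : sz_arrow C) :
  sz_dom x = sz_set y -> dom (sz_arr x) = cod (sz_arr y).
Proof. by move=> h; rewrite -(sz_cod y) -h /= cod_inv. Qed.

Lemma sz_comp_le (C : inverse_category) (x y : sz_arrow C)
    (h : sz_dom x = sz_set y) :
  le (ie (sz_set x)) (irs (comp (sz_arr x) (sz_arr y) (sz_comp_cod h))).
Proof.
have /le_irsE lx := sz_le x; have /le_irsE ly := sz_le y.
apply/le_irsE; rewrite -omulE oinvM; move: ly.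
rewrite -h ieE /= invK -/(oinv (Some (sz_arr x))).
set s := Some (sz_arr x); set t := Some (sz_arr y).
set e := Some (ie (sz_set x)) => ly.
have se z : z ** e ** s ** oinv s = z ** e.
  have := omul_idemC (ie_idem (sz_set x)) (irs_idem s).
  by rewrite -/e lx => es; rewrite -!omulA es.
by have := congr1 (fun z => s ** z ** oinv s) ly; rewrite !omulA !se lx.
Qed.

Definition sz_comp (C : inverse_category) (x y : sz_arrow C)
    (h : sz_dom x = sz_set y) : sz_arrow C :=
  @SzArrow C (sz_set x) (comp (sz_arr x) (sz_arr y) (sz_comp_cod h))
    (etrans (sz_cod x) (esym (cod_comp _))) (sz_comp_le h).

Lemma sz_dom_idn (C : inverse_category) (A : finpart C) : sz_dom (sz_idn A) = A.
Proof.
apply: finpart_eq => /=; rewrite inv_idn; apply: lmul_set_fix.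
by rewrite -cod_ie omul1.
Qed.

Lemma sz_dom_comp (C : inverse_category) (x y : sz_arrow C)
  (h : sz_dom x = sz_set y) : sz_dom (sz_comp h) = sz_dom y.
Proof.
apply: finpart_eq; rewrite /= -h /=; symmetry; apply: lmul_setM.
by have := oinvM (Some (sz_arr x)) (Some (sz_arr y)); rewrite (omulE (sz_comp_cod h)).
Qed.

Lemma sz_comp_idl (C : inverse_category) (x : sz_arrow C)
  (h : sz_dom (sz_idn (sz_set x)) = sz_set x) : sz_comp h = x.
Proof.
apply: sz_arrow_eq => //=; apply: (@osome_inj C).
by rewrite -omulE sz_cod omul1.
Qed.

Lemma sz_comp_idr (C : inverse_category) (x : sz_arrow C)
  (h : sz_dom x = sz_set (sz_idn (sz_dom x))) : sz_comp h = x.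
Proof.
apply: sz_arrow_eq => //=; apply: (@osome_inj C).
by rewrite -omulE /= cod_inv omulr1.
Qed.

Lemma sz_compA (C : inverse_category) (x y z : sz_arrow C)
    (hxy : sz_dom x = sz_set y) (hyz : sz_dom y = sz_set z)
    (h1 : sz_dom x = sz_set (sz_comp hyz)) (h2 : sz_dom (sz_comp hxy) = sz_set z) :
  sz_comp h1 = sz_comp h2.
Proof. by apply: sz_arrow_eq => //=; apply: compA. Qed.

Definition sz_category (C : inverse_category) : category :=
  @Category (finpart C) (sz_arrow C) (@sz_dom C) (@sz_set C) (@sz_idn C)
    (@sz_comp C) (@sz_dom_idn C) (fun=> erefl) (@sz_dom_comp C)
    (fun _ _ _ => erefl) (@sz_comp_idl C) (@sz_comp_idr C) (@sz_compA C).

Lemma sz_inv_le (C : inverse_category) (x : sz_arrow C) :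
  le (ie (sz_dom x)) (irs (inv (sz_arr x))).
Proof.
by apply/le_irsE; rewrite ieE !omulA /= invK; have /= -> := omulKV (Some (sz_arr x)).
Qed.

(* (s°A, s°) *)
Definition sz_inv (C : inverse_category) (x : sz_arrow C) : sz_arrow C :=
  @SzArrow C (sz_dom x) (inv (sz_arr x)) erefl (sz_inv_le x).

Lemma sz_dom_inv (C : inverse_category) (x : sz_arrow C) :
  sz_dom (sz_inv x) = sz_set x.
Proof.
apply: finpart_eq => /=; rewrite invK (lmul_setM _ (esym (irsE _))).
by apply: lmul_set_fix; rewrite irsE; apply/le_irsE/sz_le.
Qed.

Lemma sz_inv_inverse (C : inverse_category) (x : sz_category C) :
  inverse_of x (sz_inv x : sz_category C).
Proof.
exists erefl, (sz_dom_inv x); split; apply: sz_arrow_eq => //=;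
  apply: (@osome_inj C); rewrite -!omulE.
  exact: (omulVK (Some (sz_arr x))).
exact: (omulKV (Some (sz_arr x))).
Qed.

Lemma sz_invP (C : inverse_category) (x : sz_category C) :
  exists! y : sz_category C, inverse_of x y.
Proof.
exists (sz_inv x : sz_category C); split; first exact: sz_inv_inverse.
move=> y [h1 [h2 [e1 e2]]].
apply: sz_arrow_eq => /=; first by rewrite -[sz_set y]h1.
apply: inv_uniq; apply/inverse_of_omul.
have /= := congr1 (fun z : sz_arrow C => Some (sz_arr z)) e1.
have /= := congr1 (fun z : sz_arrow C => Some (sz_arr z)) e2.
by rewrite -!omulE.
Qed.

Definition Sz (C : inverse_category) : inverse_category :=
  @InverseCategory (sz_category C) (@sz_invP C).

Lemma Sz_inv (C : inverse_category) (x : Sz C) : inv x = sz_inv x.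
Proof. by apply: inv_uniq; apply: sz_inv_inverse. Qed.

(* In Sz(C), dom x = cod y is the condition for (A,s)(B,t) to be
   defined: st is defined, iε(B) <= id(s) and A = sB. *)
Lemma Sz_composable (C : inverse_category) (x y : Sz C) :
  dom x = cod y <->
  [/\ dom (sz_arr x) = cod (sz_arr y), le (ie (sz_set y)) (ids (sz_arr x))
    & elems (sz_set x) = lmul_set (sz_arr x) (elems (sz_set y))].
Proof.
rewrite /=; split=> [h|[h l e]].
  have e := sz_dom_inv x; split; first exact: sz_comp_cod.
    by rewrite -h -[sz_arr x]invK ids_inv; apply: sz_inv_le.
  by rewrite -{1}e -h /= invK.
apply: finpart_eq => /=; rewrite e (lmul_setM _ (esym (idsE _))).
by apply: lmul_set_fix; rewrite idsE; apply/le_idsE.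
Qed.

Record functor (C D : category) := Functor {
  fob : ob C -> ob D;
  farr :> C -> D;
  dom_farr : forall s, dom (farr s) = fob (dom s);
  cod_farr : forall s, cod (farr s) = fob (cod s);
  farr_idn : forall X, farr (idn X) = idn (fob X);
  farr_comp : forall s t (h : dom s = cod t)
    (h' : dom (farr s) = cod (farr t)),
    farr (comp s t h) = comp (farr s) (farr t) h' }.

Lemma functor_eq (C D : category) (f g : functor C D) : farr f =1 farr g -> f = g.
Proof.
case: f g => [fo fa fd fc fi fm] [go ga gd gc gi gm] /= /funext fg.
case: ga / fg gd gc gi gm => gd gc gi gm.
have fgo : fo = go by apply/funext => X; rewrite -[X]dom_idn -fd gd.
case: go / fgo gd gc gi gm => gd gc gi gm.
by congr Functor; apply: Prop_irrelevance.
Qed.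

Lemma fid_comp (C : category) (s t : C) (h h' : dom s = cod t) :
  comp s t h = comp s t h'.
Proof. by rewrite (Prop_irrelevance h h'). Qed.

Definition fid (C : category) : functor C C :=
  @Functor C C (fun X => X) (fun s => s) (fun=> erefl) (fun=> erefl)
    (fun=> erefl) (@fid_comp C).

Lemma fcomp_dom (C D E : category) (g : functor D E) (f : functor C D) (s : C) :
  dom (g (f s)) = fob g (fob f (dom s)).
Proof. by rewrite !dom_farr. Qed.

Lemma fcomp_cod (C D E : category) (g : functor D E) (f : functor C D) (s : C) :
  cod (g (f s)) = fob g (fob f (cod s)).
Proof. by rewrite !cod_farr. Qed.

Lemma fcomp_idn (C D E : category) (g : functor D E) (f : functor C D) (X : ob C) :
  g (f (idn X)) = idn (fob g (fob f X)).
Proof. by rewrite !farr_idn. Qed.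

Lemma fcomp_comp (C D E : category) (g : functor D E) (f : functor C D) (s t : C)
    (h : dom s = cod t) (h' : dom (g (f s)) = cod (g (f t))) :
  g (f (comp s t h)) = comp (g (f s)) (g (f t)) h'.
Proof.
have k : dom (f s) = cod (f t) by rewrite dom_farr cod_farr h.
by rewrite (farr_comp h k) (farr_comp k h').
Qed.

(* first f, then g *)
Definition fcomp (C D E : category) (g : functor D E) (f : functor C D) :
    functor C E :=
  @Functor C E (fun X => fob g (fob f X)) (fun s => g (f s))
    (fcomp_dom g f) (fcomp_cod g f) (fcomp_idn g f) (@fcomp_comp C D E g f).

Definition is_endofunctor (F0 : inverse_category -> inverse_category)
    (F1 : forall C D : inverse_category, functor C D -> functor (F0 C) (F0 D)) :
    Prop :=
  (forall C : inverse_category, F1 C C (fid C) = fid (F0 C)) /\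
  (forall (C D E : inverse_category) (g : functor D E) (f : functor C D),
     F1 C E (fcomp g f) = fcomp (F1 D E g) (F1 C D f)).

Definition is_natural_to_id (F0 : inverse_category -> inverse_category)
    (F1 : forall C D : inverse_category, functor C D -> functor (F0 C) (F0 D))
    (eta : forall C : inverse_category, functor (F0 C) C) : Prop :=
  forall (C D : inverse_category) (f : functor C D),
    fcomp f (eta C) = fcomp (eta D) (F1 C D f).

Definition is_expansion (F0 : inverse_category -> inverse_category)
    (F1 : forall C D : inverse_category, functor C D -> functor (F0 C) (F0 D)) :
    Prop :=
  is_endofunctor F1 /\
  exists eta : forall C : inverse_category, functor (F0 C) C,
    is_natural_to_id F1 eta /\
    forall (C : inverse_category) (s : C), exists x : F0 C, eta C x = s.

(* Main.v *)
From mathcomp Require Import all_boot.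
From mathcomp Require Import boolp classical_sets cardinality.
Require Import Defs.

Set Implicit Arguments.
Unset Strict Implicit.
Unset Printing Implicit Defensive.

Local Open Scope classical_set_scope.

(** Everything entering the construction of the Szendrei expansion (composites,
    inverses, the idempotents ir(s), the natural order) is expressed by
    equations between composites, so a functor preserves all of it.  Inverses
    are the only point where uniqueness is used: the image of an inverse of s is
    an inverse of f(s), hence it is f(s)° ([farr_inv]).  Consequently the image
    f(A) of a set in P(C) lies in P(D), and (A, s) |-> (f(A), f(s)) is well
    defined.  It respects sources because f(sA) = f(s)f(A) whenever sA is
    defined ([lmul_set_image]), the source of (A, s) being s°A.

    An arrow of the expansion is determined by its two components, and the
    functor acts on each of them by taking images under f; functoriality in f is
    therefore functoriality of the image.  The projection (A, s) |-> s is the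
    natural transformation eta; it is surjective because ({s}, s) is an arrow of
    the expansion for every s. *)

Lemma farr_composable (C D : category) (f : functor C D) (s t : C) :
  dom s = cod t -> dom (f s) = cod (f t).
Proof. by move=> h; rewrite dom_farr cod_farr h. Qed.

(** The implication cannot be strengthened to an equality of partial products: a
    functor that identifies objects creates new composable pairs. *)
Lemma farr_omul (C D : category) (f : functor C D) (s t u : C) :
  omul (Some s) (Some t) = Some u -> omul (Some (f s)) (Some (f t)) = Some (f u).
Proof.
move=> /omul_some[h ->].
by rewrite (omulE (farr_composable f h)) (farr_comp h (farr_composable f h)).
Qed.

Lemma farr_inverse_of (C D : category) (f : functor C D) (s t : C) :
  inverse_of s t -> inverse_of (f s) (f t).
Proof.
move=> [h1 [h2 [e1 e2]]]; apply/inverse_of_omul.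
have p1 := farr_omul f (omulE h1).
have p2 := farr_omul f (omulE h2).
rewrite p1 p2; split; apply: farr_omul.
- by rewrite (omulE (etrans (dom_comp h1) h2)) e1.
- by rewrite (omulE (etrans (dom_comp h2) h1)) e2.
Qed.

Lemma farr_inv (C D : inverse_category) (f : functor C D) (s : C) :
  f (inv s) = inv (f s).
Proof. by apply/esym/inv_uniq/farr_inverse_of/invP. Qed.

Lemma farr_irs (C D : inverse_category) (f : functor C D) (s : C) :
  f (irs s) = irs (f s).
Proof.
apply: osome_inj; rewrite irsE /= -farr_inv; apply/esym/farr_omul.
by rewrite irsE.
Qed.

Lemma farr_le (C D : category) (f : functor C D) (s t : C) :
  le s t -> le (f s) (f t).
Proof.
move=> [e [[h ee] [k ->]]]; apply/leE; exists (Some (f e)); split.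
- by apply: farr_omul; rewrite (omulE h) ee.
- by apply/esym/farr_omul; rewrite (omulE k).
Qed.

(** Composability of s with all of A is what makes the right-hand side large
    enough: f(s) may become composable with f(a) for an a with which s is not. *)
Lemma lmul_set_image (C D : category) (f : functor C D) (s : C) (A : set C) :
  (forall a, A a -> dom s = cod a) ->
  lmul_set (f s) (f @` A) = f @` lmul_set s A.
Proof.
move=> hA; apply/seteqP; split=> v.
  move=> [_ [a Aa <-] [h ->]].
  exists (comp s a (hA a Aa)); first by exists a => //; exists (hA a Aa).
  exact: farr_comp.
move=> [_ [a Aa [h ->]] <-].
exists (f a); first by exists a.
by exists (farr_composable f h); exact: farr_comp.
Qed.

Section SzFunctor.
Variables (C D : inverse_category) (f : functor C D).

Lemma image_cod (A : finpart C) (b : D) :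
  (f @` elems A) b -> cod b = fob f (oe A).
Proof. by move=> [a Aa <-]; rewrite cod_farr (elems_cod Aa). Qed.

Lemma image_irs (A : finpart C) (b : D) : (f @` elems A) b -> irs b = f (ie A).
Proof. by move=> [a Aa <-]; rewrite -farr_irs (elems_irs Aa). Qed.

Lemma image_elems_nonempty (A : finpart C) : f @` elems A !=set0.
Proof. by have [a Aa] := elems_nonempty A; exists (f a), a. Qed.

Definition finpart_image (A : finpart C) : finpart D :=
  @FinPart D (f @` elems A) (fob f (oe A)) (f (ie A))
    (finite_image f (elems_finite A)) (image_elems_nonempty A)
    (@image_cod A) (@image_irs A).

Lemma sz_map_cod (x : sz_arrow C) :
  oe (finpart_image (sz_set x)) = cod (f (sz_arr x)).
Proof. by rewrite cod_farr -sz_cod. Qed.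

Lemma sz_map_le (x : sz_arrow C) :
  le (ie (finpart_image (sz_set x))) (irs (f (sz_arr x))).
Proof. by rewrite -farr_irs; apply/farr_le/sz_le. Qed.

Definition sz_map (x : Sz C) : Sz D :=
  @SzArrow D (finpart_image (sz_set x)) (f (sz_arr x))
    (sz_map_cod x) (sz_map_le x).

Lemma sz_map_dom (x : Sz C) : dom (sz_map x) = finpart_image (dom x) :> ob (Sz D).
Proof.
apply: finpart_eq; rewrite /= -farr_inv; apply: lmul_set_image => a Aa.
by rewrite dom_inv (elems_cod Aa) sz_cod.
Qed.

Lemma sz_map_idn (A : ob (Sz C)) :
  sz_map (idn A) = idn (finpart_image A : ob (Sz D)).
Proof. by apply: sz_arrow_eq => //=; rewrite farr_idn. Qed.

Lemma sz_map_comp (x y : Sz C) (h : dom x = cod y)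
    (h' : dom (sz_map x) = cod (sz_map y)) :
  sz_map (comp x y h) = comp (sz_map x) (sz_map y) h'.
Proof. by apply: sz_arrow_eq => //=; apply: farr_comp. Qed.

Definition sz_functor : functor (Sz C) (Sz D) :=
  @Functor (Sz C) (Sz D) finpart_image sz_map sz_map_dom (fun=> erefl)
    sz_map_idn sz_map_comp.

End SzFunctor.

Lemma sz_functor_endofunctor : is_endofunctor sz_functor.
Proof.
split=> [C|C D E g f]; apply: functor_eq => x; apply: sz_arrow_eq => //=.
- exact: image_id.
- by rewrite image_comp.
Qed.

Lemma sz_proj_dom (C : inverse_category) (x : Sz C) :
  dom (sz_arr x) = oe (dom x : finpart C).
Proof. by rewrite /= cod_inv. Qed.

Lemma sz_proj_cod (C : inverse_category) (x : Sz C) :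
  cod (sz_arr x) = oe (cod x : finpart C).
Proof. by rewrite /= sz_cod. Qed.

Lemma sz_proj_comp (C : inverse_category) (x y : Sz C) (h : dom x = cod y)
    (h' : dom (sz_arr x) = cod (sz_arr y)) :
  sz_arr (comp x y h) = comp (sz_arr x) (sz_arr y) h'.
Proof. exact: fid_comp. Qed.

Definition sz_proj (C : inverse_category) : functor (Sz C) C :=
  @Functor (Sz C) C (@oe C) (@sz_arr C) (@sz_proj_dom C) (@sz_proj_cod C)
    (fun=> erefl) (@sz_proj_comp C).

Lemma sz_proj_natural : is_natural_to_id sz_functor sz_proj.
Proof. by move=> C D f; apply: functor_eq. Qed.

Definition finpart1 (C : inverse_category) (s : C) : finpart C.
Proof.
apply: (@FinPart C [set s] (cod s) (irs s)).
- exact: finite_set1.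
- by exists s.
- by move=> a ->.
- by move=> a ->.
Defined.

Lemma finpart1_le (C : inverse_category) (s : C) :
  le (ie (finpart1 s)) (irs s).
Proof. by apply/le_irsE; rewrite /= irsE irs_idem. Qed.

Lemma sz_proj_surj (C : inverse_category) (s : C) : exists x, sz_proj C x = s.
Proof. by exists (@SzArrow C (finpart1 s) s erefl (finpart1_le s)). Qed.

Theorem proposition4p5 :
  exists Szf : forall C D : inverse_category, functor C D -> functor (Sz C) (Sz D),
    (forall (C D : inverse_category) (f : functor C D) (x : Sz C),
       elems (sz_set (Szf C D f x)) = f @` elems (sz_set x) /\
       sz_arr (Szf C D f x) = f (sz_arr x)) /\
    is_expansion Szf.
Proof.
exists sz_functor; split=> [//|]; split; first exact: sz_functor_endofunctor.
by exists sz_proj; split; [exact: sz_proj_natural | exact: sz_proj_surj].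
Qed.
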